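(* For every positive integer $k$ there exists $\alpha_0>0$ such that for every $\alpha\in(0,\alpha_0)$ there exists $n_0$ such that for every $n\ge n_0$ the following holds. If $J$ is a $k$-system on $n$ vertices with $$\delta(J) \geq \left(n, \left(\tfrac{k-1}{k} - \alpha\right)n, \left(\tfrac{k-2}{k} - \alpha\right) n, \dots, \left(\tfrac{1}{k} - \alpha\right) n\right)$$ (pointwise), then $J_k$ contains a matching which covers all but at most $9k^2\alpha n$ vertices of $J$.
   Context: A hypergraph is identified with its edge set. A $k$-system is a hypergraph $J$ on a vertex set $V$ in which every edge has size at most $k$ and $\emptyset \in J$. For $r \le k$, $J_r$ denotes the $r$-graph on $V$ formed by the edges of $J$ of size $r$. For an edge $e$ of $J$, its degree $d(e)$ is the number of edges $e'$ of $J$ of size $|e|+1$ with $e \subseteq e'$. The minimum $r$-degree $\delta_r(J)$ is the minimum of $d(e)$ over edges $e$ of size $r$, and the degree sequence is $\delta(J)=(\delta_0(J),\dots,\delta_{k-1}(J))$; $\delta(J)\ge \mathbf a$ means $\delta_i(J)\ge a_i$ for all $i$. A matching is a set of pairwise disjoint edges. *)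

(* Defs.v *)
From mathcomp Require Import all_boot.
From Stdlib Require Import Reals.
Set Implicit Arguments. Unset Strict Implicit. Unset Printing Implicit Defensive.

Definition hypergraph (T : finType) := {set {set T}}.

Definition ksystem (T : finType) (k : nat) (J : hypergraph T) : Prop :=
  set0 \in J /\ (forall e, e \in J -> #|e| <= k).

Definition deg (T : finType) (J : hypergraph T) (e : {set T}) : nat :=
  #|[set f in J | (#|f| == #|e|.+1) && (e \subset f)]|.

Definition layer (T : finType) (J : hypergraph T) (r : nat) : hypergraph T :=
  [set e in J | #|e| == r].

Definition is_matching (T : finType) (M : hypergraph T) : Prop :=
  forall e f, e \in M -> f \in M -> e != f -> [disjoint e & f].

Definition covered (T : finType) (M : hypergraph T) : {set T} :=
  \bigcup_(e in M) e.

(* Main.v *)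
From Stdlib Require Import Reals.
From mathcomp Require Import Rstruct reals sequences exp.
From mathcomp Require Import all_boot all_order all_algebra.
From mathcomp Require Import ring lra zify.
Require Import Defs.
Set Implicit Arguments. Unset Strict Implicit. Unset Printing Implicit Defensive.
Import Order.TTheory GRing.Theory Num.Theory.

(** A derandomised greedy algorithm with exponential weights. Suppose first that
    the degrees exceed [(k - i) / k] times the number of vertices by a small
    constant factor. Edges of size [k] are removed one at a time, and one has to
    make sure that, for every edge [f], the neighbourhood of [f] keeps its
    proportion in the set [S] of remaining vertices. Give each [f] the weight
    [exp (lam * deficit f)], where the deficit of [f] is [(k - |f|) / k] minus
    the density of its neighbourhood in [S], and let the cost of a vertex be the
    total weight of the neighbourhoods containing it. As long as all deficits
    are nonpositive, building an edge by repeatedly adding the cheapest available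
    vertex gives an edge of cost at most [k] times the average cost. Removing it
    does not increase the sum of the weights to first order, and the second-order
    terms are negligible over the whole process, so the sum of weights stays
    below [1] and no deficit ever becomes positive.

    The general case reduces to this one by adding about [2 k alpha n] dummy
    vertices that are compatible with everything. *)

Local Open Scope ring_scope.

(** * Neighbourhoods and cheap edges *)

Definition nbr (T : finType) (J : hypergraph T) (f : {set T}) : {set T} :=
  [set v | (v \notin f) && (v |: f \in J)].

Lemma nbrP (T : finType) (J : hypergraph T) (f : {set T}) (v : T) :
  reflect (v \notin f /\ v |: f \in J) (v \in nbr J f).
Proof. by rewrite inE; apply: (iffP andP). Qed.

Lemma deg_nbr (T : finType) (J : hypergraph T) (f : {set T}) :
  deg J f = #|nbr J f|.
Proof.
have inj : {in nbr J f &, injective (fun v => v |: f)}.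
  move=> v w /nbrP[vf _] /nbrP[wf _] /setP/(_ v).
  by rewrite !in_setU1 eqxx (negbTE vf) !orbF => /esym/eqP.
rewrite -(card_in_imset inj) /deg; apply: eq_card => g.
rewrite inE; apply/idP/imsetP => [/and3P[gJ /eqP cg fg]|[v /nbrP[vf vJ] ->]]; last first.
  by rewrite vJ cardsU1 vf eqxx subsetUr.
have /cards1P[v gf] : #|g :\: f| == 1%N by rewrite cardsDS // cg subSnn.
have gE : g = v |: f by rewrite -gf setUC -{1}(setIidPr fg) setID.
have /setDP[_ vf] : v \in g :\: f by rewrite gf set11.
by exists v => //; apply/nbrP; rewrite -gE.
Qed.

(* Always adding the cheapest available vertex works: if it costs [c], at least
   [(k - |f|) |S| / k] vertices of [S] cost [c] or more; [M] records the largest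
   cost paid so far. *)
Lemma light_extension (R : realFieldType) (T : finType) (J : hypergraph T)
    (k : nat) (S : {set T}) (a : T -> R) :
  (0 < k)%N -> (0 < #|S|)%N ->
  (forall f, f \in J -> f \subset S -> (#|f| < k)%N ->
     ((k - #|f|) * #|S| <= k * #|nbr J f :&: S|)%N) ->
  forall m f (M : R), f \in J -> f \subset S -> (#|f| + m)%N = k ->
  exists e, [/\ e \in J, #|e| = k, f \subset e, e \subset S &
    \sum_(v in e :\: f) a v <=
      m%:R * M + k%:R / #|S|%:R * \sum_(v in S) Num.max (a v - M) 0].
Proof.
move=> k0 S0 HJ; elim=> [|m IH] f M fJ fS fk.
  exists f; split=> //; first by rewrite -fk addn0.
  rewrite setDv big_set0 mul0r add0r mulr_ge0 ?divr_ge0 //.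
  by apply: sumr_ge0 => v _; rewrite le_max lexx orbT.
have fk' : (#|f| < k)%N by lia.
have HN := HJ f fJ fS fk'.
have [v0 v0P] : exists v, v \in nbr J f :&: S.
  by apply/set0Pn; rewrite -card_gt0; nia.
have [v vP vmin] := arg_minP a v0P.
have /setIP[/nbrP[vf vJ] vS] := vP.
have cvf : (#|v |: f| + m)%N = k by rewrite cardsU1 vf; lia.
have vfS : v |: f \subset S by rewrite subUset sub1set vS.
(* The threshold rises to [Num.max M (a v)]: a vertex dearer than [M] is paid for by the drop in the
   sum of excesses over the threshold. *)
have [e [eJ ek fe eS He]] := IH (v |: f) (Num.max M (a v)) vJ vfS cvf.
have ve : v \in e by apply: (subsetP fe); rewrite setU11.
have fe' : f \subset e by apply: subset_trans fe; apply: subsetUr.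
exists e; split=> //.
have -> : \sum_(w in e :\: f) a w = a v + \sum_(w in e :\: (v |: f)) a w.
  rewrite (bigD1 v) /=; last by rewrite inE vf.
  congr (_ + _); apply: eq_bigl => w; rewrite !inE.
  by case: (w == v); rewrite ?andbF ?andbT.
have nS : 0 < #|S|%:R :> R by rewrite ltr0n.
have [avM|Mav] := leP (a v) M.
  rewrite (max_idPl avM) in He.
  by rewrite -natr1; lra.
rewrite (max_idPr (ltW Mav)) in He.
suff H : m.+1%:R * (a v - M) <= k%:R / #|S|%:R *
   (\sum_(w in S) Num.max (a w - M) 0 - \sum_(w in S) Num.max (a w - a v) 0).
  by move: H; rewrite mulrBr -natr1; lra.
(* By minimality every vertex of [nbr J f :&: S] costs at least [a v], so its excess drops by
   exactly [a v - M]; no other excess grows. *)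
have Hc : #|nbr J f :&: S|%:R * (a v - M) <=
   \sum_(w in S) Num.max (a w - M) 0 - \sum_(w in S) Num.max (a w - a v) 0.
  rewrite -sumrB (big_setID (nbr J f)) /= -[leLHS]addr0 setIC; apply: lerD.
    rewrite mulr_natl -sumr_const; apply: ler_sum => w wN.
    have aw : a v <= a w by apply: vmin; rewrite /= setIC.
    rewrite (max_idPl _) ?(max_idPl _) ?subr_ge0 //; last lra.
    by lra.
  apply: sumr_ge0 => w _; rewrite subr_ge0 ge_max !le_max lexx orbT andbT.
  by rewrite lerD2l lerN2 ltW.
apply: le_trans (ler_wpM2l _ Hc); last by rewrite divr_ge0.
rewrite mulrA ler_pM2r ?subr_gt0 // mulrAC ler_pdivlMr //.
have -> : m.+1 = (k - #|f|)%N by rewrite -fk addKn.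
by rewrite -natrM -natrM ler_nat.
Qed.

(** Starting from the empty set with threshold [0], the excess of a nonnegative cost is the cost
    itself. *)
Lemma light_edge (R : realFieldType) (T : finType) (J : hypergraph T)
    (k : nat) (S : {set T}) (a : T -> R) :
  (0 < k)%N -> (0 < #|S|)%N -> set0 \in J -> (forall v, 0 <= a v) ->
  (forall f, f \in J -> f \subset S -> (#|f| < k)%N ->
     ((k - #|f|) * #|S| <= k * #|nbr J f :&: S|)%N) ->
  exists e, [/\ e \in J, #|e| = k, e \subset S &
    \sum_(v in e) a v <= k%:R / #|S|%:R * \sum_(v in S) a v].
Proof.
move=> k0 S0 J0 a0 HJ.
have c0 : (#|set0 : {set T}| + k)%N = k by rewrite cards0.
have [e [eJ ek _ eS]] := light_extension a k0 S0 HJ 0 J0 (sub0set S) c0.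
rewrite setD0 mulr0 add0r => He; exists e; split=> //.
apply: le_trans He _; rewrite le_eqVlt; apply/orP; left; apply/eqP.
by congr (_ * _); apply: eq_bigr => v _; rewrite subr0; apply/max_idPl.
Qed.

(** * Exponential potential and the effect of one removal *)

Definition deficit (R : realType) (T : finType) (J : hypergraph T) (k : nat)
    (S f : {set T}) : R :=
  (k - #|f|)%:R / k%:R - #|nbr J f :&: S|%:R / #|S|%:R.

(** The empty set is left out: once all singletons are edges its deficit is [0], and its weight
    would use up the whole bound [1]. *)
Definition potential (R : realType) (T : finType) (J : hypergraph T) (k : nat)
    (lam : R) (S : {set T}) : R :=
  \sum_(f in J | (0 < #|f| < k)%N) expR (lam * deficit R J k S f).

Lemma deficit_le0 (R : realType) (T : finType) (J : hypergraph T) (k : nat)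
    (lam : R) (S f : {set T}) :
  0 < lam -> potential J k lam S <= 1 -> f \in J -> (0 < #|f| < k)%N ->
  deficit R J k S f <= 0.
Proof.
move=> l0 HP fJ fk.
have : expR (lam * deficit R J k S f) <= 1.
  apply: le_trans HP; rewrite /potential (bigD1 f) /= ?fJ // lerDl.
  by apply: sumr_ge0 => g _; apply: expR_ge0.
by rewrite expR_le1 pmulr_rle0.
Qed.

(** Invert [1 - y <= expR (- y)] and use [(1 - y) * (1 + y + 2 * y ^+ 2) = 1 + y ^+ 2 * (1 - 2 *
    y)]. *)
Lemma expR_le_quadratic (R : realType) (y : R) :
  y <= 2^-1 -> expR y <= 1 + y + 2 * y ^+ 2.
Proof.
move=> y2.
have := expR_ge1Dx (- y); rewrite expRN => H.
have y1 : 0 < 1 - y by lra.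
have : expR y <= (1 - y)^-1.
  by rewrite -[leLHS]invrK lef_pV2 ?posrE ?invr_gt0 ?expR_gt0.
move/le_trans; apply; rewrite -div1r ler_pdivrMr //.
by have := sqr_ge0 y; rewrite expr2; nra.
Qed.

(** This form is linear in the neighbour counts: summed with weights, the numerator becomes the cost
    of [e] minus [k] times the average cost, which [light_edge] makes nonpositive. *)
Lemma deficit_setD (R : realType) (T : finType) (J : hypergraph T) (k : nat)
    (S e f : {set T}) :
  (k < #|S|)%N -> e \subset S -> #|e| = k ->
  deficit R J k (S :\: e) f - deficit R J k S f =
  (#|nbr J f :&: e|%:R - k%:R / #|S|%:R * #|nbr J f :&: S|%:R) / (#|S|%:R - k%:R).
Proof.
move=> kS eS ek; rewrite /deficit cardsDS // ek (natrB _ (ltnW kS)).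
have -> : #|nbr J f :&: (S :\: e)|%:R = #|nbr J f :&: S|%:R - #|nbr J f :&: e|%:R :> R.
  rewrite -natrB ?subset_leq_card ?setIS // -cardsDS ?setIS //.
  by rewrite setDIr setDIl setDv set0I set0U setIDA.
have n0 : #|S|%:R != 0 :> R by rewrite pnatr_eq0; lia.
have nk : #|S|%:R - k%:R != 0 :> R by rewrite subr_eq0 eqr_nat; lia.
rewrite [RHS]mulrBl.
set u := (k - _)%:R / k%:R.
by field; rewrite n0 nk.
Qed.

(** The edge from [light_edge] makes the first-order change nonpositive, and each exponent moves by
    at most [lam * k / m], so only the quadratic error survives. *)
Lemma potential_step (R : realType) (T : finType) (J : hypergraph T)
    (k m : nat) (lam : R) (S : {set T}) :
  (0 < k)%N -> (0 < m)%N -> (m + k <= #|S|)%N ->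
  0 < lam -> lam * k%:R / m%:R <= 2^-1 ->
  set0 \in J -> (forall v, [set v] \in J) -> potential J k lam S <= 1 ->
  exists e, [/\ e \in J, #|e| = k, e \subset S &
    potential J k lam (S :\: e) <=
      potential J k lam S * (1 + 2 * (lam * k%:R / m%:R) ^+ 2)].
Proof.
move=> k0 m0 mS l0 lk J0 J1 HP.
have kS : (k < #|S|)%N by lia.
have S0 : (0 < #|S|)%N by lia.
have kR : 0 < k%:R :> R by rewrite ltr0n.
have SR : 0 < #|S|%:R :> R by rewrite ltr0n.
have mR : 0 < m%:R :> R by rewrite ltr0n.
pose w f := expR (lam * deficit R J k S f).
pose a v : R := \sum_(f in J | (0 < #|f| < k)%N) (v \in nbr J f)%:R * w f.
have aE (A : {set T}) : \sum_(v in A) a v =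
    \sum_(f in J | (0 < #|f| < k)%N) #|nbr J f :&: A|%:R * w f.
  rewrite exchange_big /=; apply: eq_bigr => f _.
  rewrite -big_distrl /= -natr_sum; congr (_%:R * _).
  rewrite -sum1_card big_mkcond [RHS]big_mkcond /=; apply: eq_bigr => v _.
  by rewrite in_setI andbC; case: (v \in A); case: (v \in nbr J f).
have a0 v : 0 <= a v by apply: sumr_ge0 => f _; rewrite mulr_ge0 ?expR_ge0.
have HJ f : f \in J -> f \subset S -> (#|f| < k)%N ->
    ((k - #|f|) * #|S| <= k * #|nbr J f :&: S|)%N.
  move=> fJ fS fk; have [f0|f0] := posnP #|f|.
    have -> : nbr J f :&: S = S.
      apply/setIidPr/subsetP => v _; rewrite (cards0_eq f0).
      by apply/nbrP; rewrite in_set0 setU0.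
    by rewrite f0 subn0.
  have := @deficit_le0 R T J k lam S f l0 HP fJ; rewrite f0 fk => /(_ isT).
  rewrite subr_le0 ler_pdivrMr // mulrAC ler_pdivlMr // -natrM -natrM ler_nat.
  by rewrite [X in (_ <= X)%N]mulnC.
have [e [eJ ek eS He]] := light_edge k0 S0 J0 a0 HJ.
exists e; split=> //.
set q := lam * k%:R / m%:R.
pose y f := lam * (deficit R J k (S :\: e) f - deficit R J k S f).
have mk : m%:R <= #|S|%:R - k%:R :> R by rewrite lerBrDr -natrD ler_nat.
(* The numerator in [deficit_setD] is a difference of two numbers in [[0, k]], and its denominator
   is at least [m]. *)
have yq f : `|y f| <= q.
  rewrite /y deficit_setD // /q -[leRHS]mulrA normrM (gtr0_norm l0) ler_pM2l //.
  rewrite normrM normfV (gtr0_norm (_ : 0 < #|S|%:R - k%:R)); last lra.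
  apply: ler_pM; rewrite ?invr_ge0 ?lef_pV2 ?posrE //; try lra.
  have x0 : #|nbr J f :&: e|%:R <= k%:R :> R by rewrite -ek ler_nat subset_leq_card ?subsetIr.
  have x1 : 0 <= #|nbr J f :&: e|%:R :> R by [].
  have d1 : 0 <= k%:R / #|S|%:R * #|nbr J f :&: S|%:R :> R by rewrite mulr_ge0 ?divr_ge0.
  have d2 : k%:R / #|S|%:R * #|nbr J f :&: S|%:R <= k%:R :> R.
    by rewrite mulrAC ler_pdivrMr // ler_pM2l // ler_nat subset_leq_card ?subsetIr.
  by rewrite ler_norml; lra.
have sumy : \sum_(f in J | (0 < #|f| < k)%N) y f * w f <= 0.
  have -> : \sum_(f in J | (0 < #|f| < k)%N) y f * w f =
     lam / (#|S|%:R - k%:R) * (\sum_(v in e) a v - k%:R / #|S|%:R * \sum_(v in S) a v).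
    rewrite !aE mulr_sumr -sumrB mulr_sumr; apply: eq_bigr => f _.
    rewrite /y deficit_setD //.
    set A := #|_ :&: e|%:R; set B := _ * #|_ :&: S|%:R.
    have -> : k%:R / #|S|%:R * (#|nbr J f :&: S|%:R * w f) = B * w f by rewrite mulrA.
    ring.
  by apply: mulr_ge0_le0; [rewrite divr_ge0; lra|lra].
rewrite /potential.
have : \sum_(f in J | (0 < #|f| < k)%N) expR (lam * deficit R J k (S :\: e) f) <=
   \sum_(f in J | (0 < #|f| < k)%N) (w f * (1 + 2 * q ^+ 2) + y f * w f).
  apply: ler_sum => f _.
  have -> : lam * deficit R J k (S :\: e) f = lam * deficit R J k S f + y f.
    by rewrite /y; ring.
  rewrite expRD -/(w f) [y f * _]mulrC -mulrDr ler_pM2l ?expR_gt0 //.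
  apply: le_trans (expR_le_quadratic _) _.
    exact: le_trans (ler_norm _) (le_trans (yq f) lk).
  have : y f ^+ 2 <= q ^+ 2.
    by rewrite -(real_normK (num_real (y f))) lerXn2r ?nnegrE ?(le_trans _ (yq f)).
  by lra.
move/le_trans; apply; rewrite big_split /= -mulr_suml.
by lra.
Qed.

(** * Iterating the removal *)

Lemma is_matching_setU1 (T : finType) (M : hypergraph T) (e : {set T}) :
  is_matching M -> e \subset ~: covered M -> is_matching (e |: M).
Proof.
move=> HM eM.
have eMd f : f \in M -> [disjoint e & f].
  move=> fM; rewrite disjoints_subset; apply: subset_trans eM _.
  by rewrite setCS; apply: (bigcup_sup f).
move=> f g /setU1P[->|fM] /setU1P[->|gM] fg.
- by rewrite eqxx in fg.
- exact: eMd.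
- by rewrite disjoint_sym eMd.
- exact: HM.
Qed.

Lemma covered_setU1 (T : finType) (M : hypergraph T) (e : {set T}) :
  covered (e |: M) = e :|: covered M.
Proof. by rewrite /covered bigcup_setU big_set1. Qed.

(** There are at most [#|T|] rounds, so the assumed bound keeps the potential at most [1]
    throughout, and [potential_step] applies while [m + k] vertices remain. *)
Lemma matching_of_potential (R : realType) (T : finType) (J : hypergraph T)
    (k m : nat) (lam : R) :
  (0 < k)%N -> (0 < m)%N -> 0 < lam -> lam * k%:R / m%:R <= 2^-1 ->
  set0 \in J -> (forall v, [set v] \in J) ->
  potential J k lam setT * (1 + 2 * (lam * k%:R / m%:R) ^+ 2) ^+ #|T| <= 1 ->
  exists M : hypergraph T, [/\ M \subset layer J k, is_matching M &
    (#|~: covered M| <= m + k)%N].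
Proof.
move=> k0 m0 l0 lk J0 J1; set q := 2 * _ => Hq.
have q0 : 0 <= q by rewrite mulr_ge0 ?sqr_ge0.
have P0 A : 0 <= potential J k lam A by apply: sumr_ge0 => f _; apply: expR_ge0.
have step t : (t * k + m <= #|T|)%N -> exists M : hypergraph T, [/\ M \subset layer J k,
    is_matching M, #|covered M| = (t * k)%N &
    potential J k lam (~: covered M) <= potential J k lam setT * (1 + q) ^+ t].
  elim: t => [|t IH] tk.
    exists set0; split; rewrite ?sub0set //.
    - by move=> e f; rewrite in_set0.
    - by rewrite /covered big_set0 cards0.
    - by rewrite /covered big_set0 setC0 expr0 mulr1.
  have [|M [MJ HM cM PM]] := IH; first by rewrite mulSn in tk; lia.
  have PM1 : potential J k lam (~: covered M) <= 1.
    apply: le_trans PM (le_trans _ Hq); apply: ler_wpM2l => //.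
    apply: ler_weXn2l; first by rewrite lerDl.
    by apply: leq_trans (leq_pmulr t k0) _; rewrite mulSn in tk; lia.
  have cC : #|~: covered M| = (#|T| - t * k)%N by rewrite cardsCs setCK cM.
  have mS : (m + k <= #|~: covered M|)%N by rewrite cC; rewrite mulSn in tk; lia.
  have [e [eJ ek eS He]] := potential_step k0 m0 mS l0 lk J0 J1 PM1.
  exists (e |: M); split.
  - by rewrite subUset MJ andbT sub1set inE eJ ek eqxx.
  - exact: is_matching_setU1.
  - rewrite covered_setU1 cardsU mulSn ek cM.
    by move: eS; rewrite -disjoints_subset -setI_eq0 => /eqP->; rewrite cards0 subn0.
  - rewrite covered_setU1 setUC setCU -setDE; apply: le_trans He _.
    by rewrite -/q exprSr mulrA ler_wpM2r ?addr_ge0.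
have [mT|Tm] := leqP m #|T|; last first.
  exists set0; split; rewrite ?sub0set //; first by move=> e f; rewrite in_set0.
  by apply: leq_trans (max_card _) _; lia.
(* After this many rounds, [m] plus a remainder below [k] vertices are left. *)
have [|M [MJ HM cM _]] := step ((#|T| - m) %/ k)%N.
  by have := leq_trunc_div (#|T| - m) k; lia.
exists M; split=> //; rewrite cardsCs setCK cM.
by have := divn_eq (#|T| - m) k; have := ltn_pmod (#|T| - m) k0; lia.
Qed.

(** * Initial potential and choice of parameters *)

Lemma card_small_sets (T : finType) (A : {set {set T}}) (k : nat) :
  (forall f, f \in A -> (#|f| < k)%N) -> (0 < #|T|)%N -> (#|A| <= k * #|T| ^ k)%N.
Proof.
move=> HA T0.
have /subset_leq_card/leq_trans : A \subset \bigcup_(j < k) [set f : {set T} | #|f| == j].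
  apply/subsetP => f /HA fk; apply/bigcupP; exists (Ordinal fk) => //.
  by rewrite inE.
apply; apply: (@leq_trans (\sum_(j < k) 'C(#|T|, j))).
  elim/big_ind2: _ => [|A1 n1 A2 n2 H1 H2|j _]; first by rewrite cards0.
    by apply: leq_trans (leq_card_setU _ _) (leq_add H1 H2).
  by rewrite card_draws.
rewrite -[k in (k * _)%N]card_ord -sum_nat_const; apply: leq_sum => j _.
apply: leq_trans (_ : #|T| ^_ j <= _)%N.
  by rewrite -bin_ffact leq_pmulr ?fact_gt0.
apply: (@leq_trans (#|T| ^ j)%N); last by rewrite leq_pexp2l // ltnW.
rewrite ffact_prod -[j in (_ ^ j)%N]card_ord -prod_nat_const.
by apply: leq_prod => i _; apply: leq_subr.
Qed.

Lemma potential_initial (R : realType) (T : finType) (J : hypergraph T) (k : nat)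
    (lam eps : R) :
  (0 < #|T|)%N -> 0 < lam ->
  (forall f, f \in J -> (0 < #|f| < k)%N ->
     ((k - #|f|)%:R / k%:R + eps) * #|T|%:R <= #|nbr J f|%:R) ->
  potential J k lam setT <= (k * #|T| ^ k)%:R * expR (- (lam * eps)).
Proof.
move=> T0 l0 HJ; have TR : 0 < #|T|%:R :> R by rewrite ltr0n.
rewrite /potential.
apply: (@le_trans _ _ (\sum_(f in J | (0 < #|f| < k)%N) expR (- (lam * eps)))).
  apply: ler_sum => f /andP[fJ fk]; rewrite ler_expR -mulrN ler_pM2l //.
  have := HJ f fJ fk; rewrite -ler_pdivlMr // /deficit setIT cardsT.
  by lra.
rewrite sumr_const mulr_natl -[leLHS]mulr_natl -[leRHS]mulr_natl ler_pM2r ?expR_gt0 //.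
rewrite ler_nat -cardsE; apply: card_small_sets => // f.
by rewrite inE => /andP[_ /andP[]].
Qed.

(* The potential starts below [k N ^ k exp (- lam eps)] and is multiplied by at
   most [1 + 2 (lam k / (eps N)) ^ 2] in each of at most [N] rounds, so with
   [lam = eps ^ 3 N / (4 k ^ 2)] it stays below [1] once [N] is large. *)
Lemma almost_perfect_matching (R : realType) (k : nat) (eps : R) :
  (0 < k)%N -> 0 < eps -> eps <= 1 ->
  exists N0 : nat, forall (T : finType) (J : hypergraph T), (N0 <= #|T|)%N ->
    set0 \in J -> (forall v, [set v] \in J) ->
    (forall f, f \in J -> (0 < #|f| < k)%N ->
       ((k - #|f|)%:R / k%:R + eps) * #|T|%:R <= #|nbr J f|%:R) ->
    exists M : hypergraph T, [/\ M \subset layer J k, is_matching M &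
      #|~: covered M|%:R <= 2 * eps * #|T|%:R].
Proof.
move=> k0 e0 e1.
have kR : 0 < k%:R :> R by rewrite ltr0n.
have k1 : 1 <= k%:R :> R by rewrite ler1n.
(* With this [c], the growth over all rounds is at most [expR (c * N)], while
   [lam * eps = 2 * (c * N)]. *)
pose c : R := eps ^+ 4 / (8 * k%:R ^+ 2).
have c0 : 0 < c by rewrite divr_gt0 ?mulr_gt0 ?exprn_gt0.
(* [N >= B1] gives [k * N ^ k <= (c * N / k.+1) ^ k.+1]; [N >= B2] gives [k.+1 <= eps * N], which
   absorbs the final [k] and the rounding of [m]. *)
pose B1 : R := k%:R * (k.+1%:R / c) ^+ k.+1.
pose B2 : R := k.+1%:R / eps.
have B1_0 : 0 <= B1.
  by apply/mulr_ge0/exprn_ge0/divr_ge0/ltW.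
have B2_0 : 0 <= B2 by apply/divr_ge0/ltW.
exists (Num.truncn (B1 + B2)).+1 => T J NT J0 J1 HJ.
have NR : B1 + B2 <= #|T|%:R.
  by apply: ltW; apply: lt_le_trans (truncnS_gt _) _; rewrite ler_nat.
have T0 : (0 < #|T|)%N by apply: leq_trans NT.
have TR : 0 < #|T|%:R :> R by rewrite ltr0n.
set N : R := #|T|%:R in NR TR *.
pose m := (Num.truncn (eps * N)).+1.
have mlo : eps * N <= m%:R by apply: ltW; apply: truncnS_gt.
have mhi : m%:R <= eps * N + 1.
  by rewrite /m -natr1 lerD2r; rewrite truncn_le mulr_ge0 ?ltW.
have mR : 0 < m%:R :> R by rewrite ltr0n.
pose lam : R := eps ^+ 3 * N / (4 * k%:R ^+ 2).
have l0 : 0 < lam by rewrite divr_gt0 ?mulr_gt0 ?exprn_gt0.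
have eN : 0 < eps * N by rewrite mulr_gt0.
have lkm : lam * k%:R / m%:R <= eps ^+ 2 / (4 * k%:R).
  apply: (@le_trans _ _ (lam * k%:R / (eps * N))).
    rewrite ler_pM2l; last exact: mulr_gt0.
    by rewrite lef_pV2 ?posrE.
  rewrite le_eqVlt; apply/orP; left; apply/eqP; rewrite /lam.
  by field; rewrite !gt_eqF.
have lkm0 : 0 <= lam * k%:R / m%:R by apply: ltW; rewrite divr_gt0 // mulr_gt0.
have e21 : eps ^+ 2 <= 1 by rewrite exprn_ile1 // ltW.
have lkm2 : lam * k%:R / m%:R <= 2^-1.
  apply: le_trans lkm _; rewrite ler_pdivrMr ?mulr_gt0 //; lra.
have [//|M [MJ HM HC]] := matching_of_potential k0 (ltn0Sn _) l0 lkm2 J0 J1 _.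
  have HP := potential_initial T0 l0 HJ.
  set q := lam * k%:R / m%:R in lkm lkm0 lkm2 *.
  have q2 : q ^+ 2 <= (eps ^+ 2 / (4 * k%:R)) ^+ 2.
    rewrite lerXn2r ?nnegrE //; apply: divr_ge0; last exact: mulr_ge0.
    by apply/exprn_ge0/ltW.
  have Hq : (1 + 2 * q ^+ 2) ^+ #|T| <= expR (c * N).
    apply: (@le_trans _ _ (expR (2 * q ^+ 2) ^+ #|T|)).
      rewrite lerXn2r ?nnegrE ?expR_ge0 ?expR_ge1Dx //.
      by rewrite addr_ge0 // mulr_ge0 ?sqr_ge0.
    rewrite -expRM_natr ler_expR ler_pM2r //.
    suff -> : c = 2 * (eps ^+ 2 / (4 * k%:R)) ^+ 2 by rewrite ler_pM2l.
    by rewrite /c; field; rewrite gt_eqF.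
  have le : lam * eps = 2 * (c * N) by rewrite /lam /c; field; rewrite gt_eqF.
  apply: (@le_trans _ _ ((k * #|T| ^ k)%:R * expR (- (lam * eps)) * expR (c * N))).
    apply: ler_pM => //; last first.
      by rewrite exprn_ge0 // addr_ge0 // mulr_ge0 ?sqr_ge0.
    by apply: sumr_ge0 => f _; apply: expR_ge0.
  rewrite -mulrA -expRD le.
  have -> : - (2 * (c * N)) + c * N = - (c * N) by ring.
  rewrite expRN ler_pdivrMr ?expR_gt0 // mul1r.
  (* Splitting the exponent into [k.+1] equal parts and using [x <= expR x] on each yields a power
     of [N] one above [N ^ k]. *)
  have -> : c * N = (c * N / k.+1%:R) * k.+1%:R by rewrite divfK // pnatr_eq0.
  rewrite expRM_natr.
  apply: (@le_trans _ _ ((c * N / k.+1%:R) ^+ k.+1)); last first.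
    apply: lerXn2r; rewrite ?nnegrE ?expR_ge0 //.
      by rewrite divr_ge0 // mulr_ge0 // ltW.
    by apply: le_trans (expR_ge1Dx _); rewrite lerDr.
  have -> : c * N / k.+1%:R = (k.+1%:R / c)^-1 * N by rewrite invf_div mulrAC.
  rewrite exprMn exprVn [N ^+ _]exprSr.
  rewrite natrM natrX -/N mulrC mulrCA ler_pM2l ?exprn_gt0 //.
  rewrite ler_pdivlMl ?exprn_gt0 ?(divr_gt0 _ c0) // mulrC.
  by apply: le_trans NR; rewrite lerDl.
exists M; split=> //.
have HC' : #|~: covered M|%:R <= m%:R + k%:R :> R by rewrite -natrD ler_nat.
have : k.+1%:R <= eps * N.
  by rewrite mulrC -ler_pdivrMr //; apply: le_trans NR; rewrite lerDr.
rewrite -natr1; lra.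
Qed.

(** * Padding with dummy vertices *)

Lemma sum_set_split (T U : finType) (e : {set T + U}) :
  e = inl @: (inl @^-1: e) :|: inr @: (inr @^-1: e).
Proof.
apply/setP => -[x|x]; rewrite inE.
- have -> : (inl x \in inr @: (inr @^-1: e)) = false.
    by apply/negbTE/imsetP => -[].
  by rewrite mem_imset ?inE ?orbF //; apply: inl_inj.
have -> : (inr x \in inl @: (inl @^-1: e)) = false.
  by apply/negbTE/imsetP => -[].
by rewrite mem_imset ?inE //; apply: inr_inj.
Qed.

Lemma card_sum_set (T U : finType) (A : {set T}) (B : {set U}) :
  #|(inl @: A :|: inr @: B : {set T + U})| = (#|A| + #|B|)%N.
Proof.
rewrite cardsU (card_imset _ inl_inj) (card_imset _ inr_inj).
suff -> : (inl @: A :&: inr @: B : {set T + U}) = set0 by rewrite cards0 subn0.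
by apply/setP => x; rewrite !inE; apply/andP => -[/imsetP[y _ ->] /imsetP[]].
Qed.

(** The join of [J] with the complete system on [U], truncated at size [k]. *)
Definition pad (T : finType) (k : nat) (J : hypergraph T) (U : finType) :
    hypergraph (T + U)%type :=
  [set e : {set T + U} | (inl @^-1: e \in J) && (#|e| <= k)%N].

Lemma pad_set1 (T U : finType) (k : nat) (J : hypergraph T) (v : T + U) :
  (0 < k)%N -> set0 \in J -> (forall x, [set x] \in J) -> [set v] \in pad k J U.
Proof.
move=> k0 J0 J1; rewrite inE cards1 k0 andbT.
case: v => v.
- have -> : inl @^-1: [set inl v : T + U] = [set v] by apply/setP => x; rewrite !inE.
  exact: J1.
by have -> : inl @^-1: [set inr v : T + U] = set0 by apply/setP => x; rewrite !inE.
Qed.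

(** Neighbours of the real part remain neighbours of [e], and so is every dummy outside [e]. The
    dummies in [e] stand on the right to avoid truncated subtraction. *)
Lemma nbr_pad (T U : finType) (k : nat) (J : hypergraph T) (e : {set T + U}) :
  inl @^-1: e \in J -> (#|e| < k)%N ->
  (#|nbr J (inl @^-1: e)| + #|U| <= #|nbr (pad k J U) e| + #|inr @^-1: e|)%N.
Proof.
move=> eJ ek; rewrite -(cardsC (inr @^-1: e)) addnCA [leqRHS]addnC leq_add2l.
rewrite -card_sum_set; apply/subset_leq_card/subsetP => x /setUP[]/imsetP[y].
- move=> /nbrP[yA yJ] ->; have ye : inl y \notin e by rewrite inE in yA.
  apply/nbrP; split=> //; rewrite inE cardsU1 ye ek andbT.
  suff -> : inl @^-1: (inl y |: e) = y |: inl @^-1: e by [].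
  by apply/setP => z; rewrite !inE.
- rewrite !inE => ye ->; apply/andP; split=> //.
  rewrite cardsU1 ye ek andbT.
  suff -> : inl @^-1: (inr y |: e) = inl @^-1: e by [].
  by apply/setP => z; rewrite !inE.
Qed.

(** By disjointness each dummy lies in at most one edge, so discarding the edges through dummies
    uncovers at most [k] real vertices per dummy. *)
Lemma unpad_matching (T U : finType) (k : nat) (J : hypergraph T)
    (M' : hypergraph (T + U)%type) :
  M' \subset layer (pad k J U) k -> is_matching M' ->
  exists M : hypergraph T, [/\ M \subset layer J k, is_matching M &
    (#|~: covered M| <= #|~: covered M'| + k * #|U|)%N].
Proof.
move=> MJ HM.
have MP e : e \in M' -> inl @^-1: e \in J /\ #|e| = k.
  by move=> /(subsetP MJ); rewrite !inE => /andP[/andP[-> _] /eqP].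
have preK (A : {set T}) : inl @^-1: (inl @: A : {set T + U}) = A.
  by apply/setP => x; rewrite inE mem_imset //; apply: inl_inj.
pose M := [set A : {set T} | (inl @: A : {set T + U}) \in M'].
(* The real vertices lost through [u]; at most one edge contributes to the union. *)
pose B (u : U) := \bigcup_(e in M' | inr u \in e) inl @^-1: e : {set T}.
exists M; split.
- apply/subsetP => A; rewrite !inE => /MP[].
  by rewrite preK (card_imset _ inl_inj) => -> ->; rewrite eqxx.
- move=> A A'; rewrite !inE => AM AM' AA'.
  have : [disjoint (inl @: A : {set T + U}) & (inl @: A' : {set T + U})].
    by apply: HM => //; apply: contra_neq AA' => E; rewrite -(preK A) E preK.
  rewrite -!setI_eq0 -(imsetI (in2W inl_inj)) => /eqP E.
  by rewrite -(preK (A :&: A')) E; apply/eqP/setP => x; rewrite !inE.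
have cB u : (#|B u| <= k)%N.
  have [e0 /andP[e0M ue0]|H0] := pickP [pred e in M' | inr u \in e]; last first.
    by rewrite /B big_pred0 ?cards0 // => e; have := H0 e.
  have [_ <-] := MP e0 e0M.
  rewrite [X in (_ <= #|pred_of_set X|)%N](sum_set_split e0) card_sum_set.
  apply: leq_trans (leq_addr _ _); apply/subset_leq_card/bigcupsP => e /andP[eM ue].
  have [-> //|ee0] := eqVneq e e0.
  by have /disjointFr/(_ ue) := HM _ _ eM e0M ee0; rewrite ue0.
have cUB : (#|\bigcup_u B u| <= k * #|U|)%N.
  rewrite mulnC -sum_nat_const.
  elim/big_ind2: _ => [|A1 n1 A2 n2 H1 H2|u _]; first by rewrite cards0.
    by apply: leq_trans (leq_card_setU _ _) (leq_add H1 H2).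
  exact: cB.
have cI : (#|inl @^-1: (~: covered M')| <= #|~: covered M'|)%N.
  by rewrite [X in (_ <= #|pred_of_set X|)%N](sum_set_split (~: covered M')) card_sum_set leq_addr.
apply: leq_trans (leq_trans (leq_card_setU _ _) (leq_add cI cUB)).
apply/subset_leq_card/subsetP => v; rewrite !inE => vM.
have [/bigcupP[e eM ve]|//] := boolP (inl v \in covered M'); rewrite /=.
have [u ue|H0] := pickP [pred u | inr u \in e].
  apply/bigcupP; exists u => //; apply/bigcupP; exists e; rewrite ?inE //.
  by rewrite eM.
case/negP: vM; apply/bigcupP; exists (inl @^-1: e); rewrite !inE //.
suff <- : e = inl @: (inl @^-1: e) by [].
rewrite {1}(sum_set_split e).
have -> : inr @^-1: e = set0 by apply/setP => u; rewrite !inE; have := H0 u.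
by rewrite imset0 setU0.
Qed.

(* Adding [D ~ 2 k alpha n] dummy vertices, each compatible with everything,
   turns the deficit [alpha n] into a surplus; the edges through a dummy are
   discarded at the end. *)
Lemma nearly_perfect_matching (R : realType) (k : nat) (alpha : R) :
  (0 < k)%N -> 0 < alpha -> alpha <= (4 * k%:R)^-1 ->
  exists n0 : nat, forall (T : finType) (J : hypergraph T), (n0 <= #|T|)%N ->
    set0 \in J -> (forall v, [set v] \in J) ->
    (forall f, f \in J -> (0 < #|f| < k)%N ->
       ((k - #|f|)%:R / k%:R - alpha) * #|T|%:R <= #|nbr J f|%:R) ->
    exists M : hypergraph T, [/\ M \subset layer J k, is_matching M &
      #|~: covered M|%:R <= 9 * k%:R ^+ 2 * alpha * #|T|%:R].
Proof.
move=> k0 a0 ak.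
have k1 : 1 <= k%:R :> R by rewrite ler1n.
have kR : 0 < k%:R :> R by rewrite ltr0n.
have ak4 : alpha * k%:R <= 4^-1.
  by rewrite -ler_pdivlMr // -invfM.
have ale : alpha <= 4^-1 by apply: le_trans ak4; rewrite ler_peMr // ltW.
have [||N0 HN0] := @almost_perfect_matching R k (alpha / 2) k0; [lra|lra|].
(* Ensures [k * alpha * n >= 1], so that the rounding in [D] can be absorbed. *)
pose n1 := (Num.truncn (k%:R * alpha)^-1).+1.
exists (N0 + k + 2 + n1)%N => T J nT J0 J1 HJ.
set n : R := #|T|%:R in HJ *.
have n_1 : 1 <= k%:R * alpha * n.
  rewrite -ler_pdivrMl ?mulr_gt0 // mulr1; apply: ltW.
  by apply: lt_le_trans (truncnS_gt _) _; rewrite ler_nat -/n1; lia.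
have n_k : k%:R <= n by rewrite ler_nat; lia.
have n_2 : 2 <= n by rewrite ler_nat; lia.
pose D := (Num.truncn (2 * k%:R * alpha * n)).+1.
have Dlo : 2 * k%:R * alpha * n <= D%:R by apply: ltW; apply: truncnS_gt.
have Dhi : D%:R <= 2 * k%:R * alpha * n + 1.
  by rewrite /D -natr1 lerD2r truncn_le; lra.
have Dn : D%:R <= n.
  by apply: le_trans Dhi _; nra.
have cTU : #|{: T + ordinal D}| = (#|T| + D)%N by rewrite card_sum card_ord.
have [||||M' [MJ' HM' HC]] := HN0 _ (pad k J 'I_D).
- by rewrite cTU; lia.
- by rewrite inE preimset0 J0 cards0.
- by move=> v; apply: pad_set1.
- move=> e; rewrite inE => /andP[eJ _] /andP[e0 ek].
  have := nbr_pad eJ ek.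
  rewrite card_ord cTU -(ler_nat R) !natrD -/n => Hn.
  have ce : #|e| = (#|inl @^-1: e| + #|inr @^-1: e|)%N.
    by rewrite {1}(sum_set_split e) card_sum_set.
  set i := #|inl @^-1: e| in ce; set b := #|inr @^-1: e| in ce Hn.
  (* If [e] consists of dummies only, its real part is empty and the degree hypothesis says nothing;
     the singletons then give full degree. *)
  have HA : ((k - i)%:R / k%:R - alpha) * n <= #|nbr J (inl @^-1: e)|%:R.
    have [i0|i0] := posnP i; last first.
      by apply: HJ => //; rewrite -/i i0; apply: leq_ltn_trans ek; rewrite ce leq_addr.
    have -> : nbr J (inl @^-1: e) = setT.
      apply/setP => v; rewrite (cards0_eq i0) [RHS]inE.
      by apply/nbrP; rewrite in_set0 setU0.
    rewrite i0 subn0 divff ?gt_eqF // cardsT -/n.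
    by rewrite ler_piMl //; lra.
  apply: (@le_trans _ _ (((k - i)%:R / k%:R - alpha) * n + D%:R - b%:R)); last lra.
  have ik : (i <= k)%N by apply: leq_trans (ltnW ek); rewrite ce leq_addr.
  rewrite (natrB _ (ltnW ek)) (natrB _ ik) ce natrD.
  have [x xE] : exists x, x = (k%:R : R)^-1 by eexists.
  have kx : k%:R * x = 1 by rewrite xE divff ?gt_eqF.
  have x0 : 0 < x by rewrite xE invr_gt0.
  have j1 : 1 <= i%:R + b%:R :> R by rewrite -natrD ler1n -ce.
  have b0 : 0 <= b%:R :> R by [].
  have xn : 1 <= x * n by rewrite -kx mulrC ler_pM2l.
  have bxn : b%:R <= b%:R * (x * n) by rewrite ler_peMr.
  (* As [e] is nonempty, the proportion demanded of the dummies falls short of [D] by at least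
     [D / k >= 2 * alpha * n]. This pays for the missing [alpha * n] and for the surplus
     [alpha / 2 * (n + D) <= alpha * n]. The [b] dummies already used are paid for by
     [b * n / k >= b]. *)
  have xD : 2 * alpha * n <= x * D%:R.
    rewrite -[leLHS]mul1r -[X in X * _]kx.
    have -> : k%:R * x * (2 * alpha * n) = x * (2 * k%:R * alpha * n) by ring.
    by rewrite ler_pM2l.
  have jxD : x * D%:R <= (i%:R + b%:R) * (x * D%:R) by rewrite ler_peMl // mulr_ge0 // ltW.
  have aD : alpha * D%:R <= alpha * n by rewrite ler_pM2l.
  rewrite -xE !mulrBl kx; lra.
have [M [MJ HM HMC]] := unpad_matching MJ' HM'.
exists M; split=> //.
have : #|~: covered M|%:R <= #|~: covered M'|%:R + k%:R * D%:R :> R.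
  by rewrite -natrM -natrD ler_nat; rewrite card_ord in HMC.
rewrite cTU natrD -/n in HC.
(* The uncovered total is at most [alpha * (n + D) + k * D], hence at most
   [5 * k ^ 2 * alpha * n]. *)
have kD : k%:R * D%:R <= k%:R * (2 * k%:R * alpha * n + 1) by rewrite ler_pM2l.
have kan : k%:R * 1 <= k%:R * (k%:R * alpha * n) by rewrite ler_pM2l.
have aD : alpha * D%:R <= alpha * n by rewrite ler_pM2l.
have an : alpha * n <= k%:R ^+ 2 * (alpha * n).
  by rewrite ler_peMl ?expr_ge1 // mulr_ge0 // ltW.
rewrite expr2 in an *; lra.
Qed.

(* Transfer to the Stdlib reals *)
Local Close Scope ring_scope.
Open Scope R_scope.

Theorem theorem2p1 :
  forall k : nat, (0 < k)%nat ->
  exists alpha0 : R, 0 < alpha0 /\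
  forall alpha : R, 0 < alpha < alpha0 ->
  exists n0 : nat, forall n : nat, (n0 <= n)%nat ->
  forall J : hypergraph 'I_n,
    ksystem k J ->
    (* delta_0(J) >= n *)
    INR n <= INR (deg J set0) ->
    (* delta_i(J) >= ((k-i)/k - alpha) n for 1 <= i <= k-1 *)
    (forall e, e \in J -> (1 <= #|e|)%nat -> (#|e| <= k - 1)%nat ->
       (INR (k - #|e|) / INR k - alpha) * INR n <= INR (deg J e)) ->
    exists M : hypergraph 'I_n,
      M \subset layer J k /\ is_matching M /\
      INR (n - #|covered M|) <= 9 * INR k ^ 2 * alpha * INR n.
Proof.
move=> k k0; exists ((4 * k%:R)^-1)%R; split.
  by apply/RltP; rewrite invr_gt0 mulr_gt0 // ltr0n.
move=> alpha [/RltP a0 /RltP /ltW a1].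
have [n0 Hn0] := nearly_perfect_matching k0 a0 a1.
exists n0 => n nn J [J0 _] d0 dJ.
(* The condition on [deg J set0] forces every singleton to be an edge. *)
have J1 v : [set v] \in J.
  have /setP/(_ v) : nbr J set0 = setT.
    apply/eqP; rewrite eqEcard subsetT cardsT card_ord -deg_nbr -(ler_nat R).
    by rewrite -!INRE; apply/RleP.
  by rewrite [RHS]inE => /nbrP[_]; rewrite setU0.
have [||M [MJ HM HC]] := Hn0 _ J _ J0 J1.
- by rewrite card_ord.
- move=> f fJ /andP[f0 fk].
  have /RleP := dJ f fJ f0 ltac:(lia).
  by rewrite card_ord deg_nbr !INRE.
exists M; split=> //; split=> //; apply/RleP.
by move: HC; rewrite cardsCs setCK card_ord !INRE RpowE IZRposE INRE.
Qed.
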